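(* Let $\alpha, \beta \in \mathbb{Q}^{\times}\setminus \{\pm 1\}$. Suppose there is an odd prime $q$ for which (i) $v_{q}(\alpha)=v_{q}(\beta)=0$, (ii) the Legendre symbol $\left(\frac{\alpha}{q}\right)=-1$, (iii) there is an integer $k$ with $v_{q}(\alpha^{2k}-\beta) \ge v_{q}(\alpha^{q-1}-1)$. Then $\alpha,\beta$ is a special pair.
   Context: For a prime $p$, $v_p(\cdot)$ denotes the $p$-adic valuation on $\mathbb{Q}$ (extended to $\mathbb{Q}_p$). For $\gamma\in\mathbb{Q}$ with $v_p(\gamma)=0$ and $p$ odd, the Legendre symbol $\left(\frac{\gamma}{p}\right)$ is the Legendre symbol of the reduction of $\gamma$ modulo $p$ (an element of $\mathbb{F}_p^\times$). A pair $\alpha,\beta\in\mathbb{Q}^{\times}\setminus\{\pm1\}$ is called special if there are infinitely many odd primes $p$ such that (a) $v_p(\alpha)=v_p(\beta)=0$, (b) $v_p(\alpha^{2k}-\beta)\ge 1$ for some integer $k$, and (c) $\left(\frac{\alpha}{p}\right)=-1$. *)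

(* Defs.v *)
From mathcomp Require Import all_boot all_order all_algebra.
From mathcomp Require Import classical_sets cardinality constructive_ereal.

Set Implicit Arguments.
Unset Strict Implicit.
Unset Printing Implicit Defensive.

Import Order.TTheory GRing.Theory Num.Theory.

Local Open Scope ring_scope.

(* Valued in int extended by infinities, so that v_p(0) = +oo. *)
Definition padic_val (p : nat) (x : rat) : \bar int :=
  if x == 0 then +oo%E
  else ((logn p `|numq x|)%:Z - (logn p `|denq x|)%:Z)%:E.

Definition legendre_Fp (p : nat) (a : 'F_p) : int :=
  if a == 0 then 0
  else if [exists b : 'F_p, b ^+ 2 == a] then 1
  else -1.

(* ratr x is numq x / denq x computed in 'F_p: the reduction of x modulo p
   when p is prime and v_p(x) >= 0. *)
Definition legendre (p : nat) (x : rat) : int := legendre_Fp (ratr x : 'F_p).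

Definition special_pair (alpha beta : rat) : Prop :=
  infinite_set [set p : nat | [/\ prime p /\ odd p,
    padic_val p alpha = 0%:E /\ padic_val p beta = 0%:E,
    exists k : int, (1%:E <= padic_val p (alpha ^ (2 * k) - beta)%R)%E
    & legendre p alpha = -1]]%classic.

(* Main.v *)
(* Write alpha = a/b and beta = c/d in lowest terms and
   N n = d a^(2n) - c b^(2n), the numerator of alpha^(2n) - beta.  By quadratic
   reciprocity, p |-> (ab/p) extends to a periodic, completely multiplicative
   function chi on the natural numbers.  Suppose that every prime p > B dividing
   some N n has chi p = 1.  Hypothesis (iii) says that beta lies q-adically in the
   closure of the powers alpha^(2n), so there are exponents n1, n2 with
   v_q(N n1) = e and v_q(N n2) = e + 1, while N n1 and N n2 agree modulo any
   prescribed W whose number of units has bounded q-adic valuation.  Choosing W so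
   that the parts of N n1 and N n2 at the primes p <= B, p <> q, coincide and the
   cofactors agree modulo the period of chi, chi takes the same value at both
   cofactors.  But these values are (-1)^e and (-1)^(e+1), because chi q = -1 and
   the other prime factors are > B. *)

Require Import Defs.
From mathcomp Require Import all_boot all_order all_algebra.
From mathcomp Require Import cyclic finfield closed_field.
From mathcomp Require Import zify ring.
From mathcomp Require Import classical_sets cardinality constructive_ereal.

Import Order.TTheory GRing.Theory Num.Theory.

Local Open Scope ring_scope.

(** * The Legendre symbol on ['F_p]: Euler's criterion and multiplicativity *)

Lemma Fp_unitX (p : nat) (a : 'F_p) : prime p -> a != 0 -> a ^+ p.-1 = 1.
Proof.
move=> p_pr a0; apply: (mulfI a0); rewrite mulr1 -exprS prednK ?prime_gt0 //.
by have := expf_card a; rewrite card_Fp.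
Qed.

Lemma Fp_prim_root (p : nat) :
  prime p -> exists z : 'F_p, p.-1.-primitive_root z.
Proof.
move=> p_pr; have p_gt1 := prime_gt1 p_pr.
have /hasP[z _ pz] : has p.-1.-primitive_root (enum [pred a : 'F_p | a != 0]).
  apply: has_prim_root; rewrite ?enum_uniq //; first by rewrite -subn1 subn_gt0.
    apply/allP => a; rewrite mem_enum inE => a0.
    by apply/unity_rootP; apply: Fp_unitX.
  by rewrite -cardE cardC1 card_Fp.
by exists z.
Qed.

Lemma legendre_Fp_sign (p : nat) (a : 'F_p) :
  legendre_Fp a = 0 \/ legendre_Fp a = 1 \/ legendre_Fp a = -1.
Proof. by rewrite /legendre_Fp; case: ifP; [left|case: ifP; right; [left|right]]. Qed.

Lemma odd_half (p : nat) : odd p -> (p./2 * 2 = p.-1)%N.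
Proof. by move=> op; have := odd_double_half p; rewrite op -muln2; lia. Qed.

Lemma euler_criterion (p : nat) (a : 'F_p) : prime p -> odd p ->
  (legendre_Fp a)%:~R = a ^+ p./2.
Proof.
move=> p_pr op; have p_gt2 : (2 < p)%N by rewrite odd_prime_gt2.
have hp := odd_half _ op.
rewrite /legendre_Fp; case: eqVneq => [->|a0].
  by rewrite expr0n; case: p./2 hp => //; lia.
case: ifPn => [/existsP[b /eqP ba]|nsq].
  rewrite -ba -exprM mulnC hp Fp_unitX //.
  by apply: contraNneq a0 => b0; rewrite -ba b0 expr0n.
have : (a ^+ p./2) ^+ 2 == 1 by rewrite -exprM hp Fp_unitX.
rewrite sqrf_eq1 => /orP[/eqP a1|/eqP ->//].
(* A nonresidue cannot have a^((p-1)/2) = 1: writing a = z^i, the order of z would force i to be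
   even and a to be a square. *)
have [z pz] := Fp_prim_root _ p_pr.
have [[i _] /= az] := prim_rootP pz (Fp_unitX _ _ p_pr a0).
have : (p.-1 %| i * p./2)%N by rewrite (prim_order_dvd pz) exprM -az a1.
rewrite -hp mulnC dvdn_pmul2r; last by lia.
move=> /dvdnP[j ij]; case/negP: nsq; apply/existsP; exists (z ^+ j).
by rewrite -exprM -ij az.
Qed.

(** Two of the values 0, 1, -1 differ by at most 2 < p. Identities between symbols can thus be
    proved in characteristic p, where Euler's criterion and Frobenius live. *)
Lemma sign_intr_inj (R : nzRingType) (p : nat) (x y : int) :
    p \in [pchar R] -> odd p ->
    x = 0 \/ x = 1 \/ x = -1 -> y = 0 \/ y = 1 \/ y = -1 ->
  x%:~R = y%:~R :> R -> x = y.
Proof.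
move=> pR op hx hy /eqP; rewrite -subr_eq0 -rmorphB /= -(dvdz_pcharf pR).
have p_gt2 : (2 < p)%N by rewrite odd_prime_gt2 //; case/andP: pR.
rewrite dvdzE /= => xy; apply/eqP; rewrite -subr_eq0 -absz_eq0.
by apply/negP => /negP; rewrite -lt0n => /dvdn_leq /(_ xy); lia.
Qed.

Lemma legendre_FpM (p : nat) (a b : 'F_p) : prime p -> odd p ->
  legendre_Fp (a * b) = legendre_Fp a * legendre_Fp b.
Proof.
move=> p_pr op; apply: (sign_intr_inj _ _ _ _ (pchar_Fp p_pr)) => //.
- exact: legendre_Fp_sign.
- by case: (legendre_Fp_sign _ a) => [|[]] ->; case: (legendre_Fp_sign _ b) => [|[]] ->; lia.
by rewrite rmorphM /= !euler_criterion // exprMn.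
Qed.

Lemma legendre_Fp1 (p : nat) : prime p -> legendre_Fp (1 : 'F_p) = 1.
Proof.
move=> p_pr; rewrite /legendre_Fp oner_eq0; case: ifPn => // /existsP[].
by exists 1; rewrite expr1n.
Qed.

Lemma legendre_Fp_eq0 (p : nat) (a : 'F_p) : (legendre_Fp a == 0) = (a == 0).
Proof. by rewrite /legendre_Fp; case: (a == 0) => //; case: ifP. Qed.

Lemma legendre_Fp_sqr (p : nat) (a : 'F_p) : a != 0 -> legendre_Fp a ^+ 2 = 1.
Proof. by rewrite /legendre_Fp => /negPf ->; case: ifP. Qed.

Lemma nonresidue_exists (p : nat) : prime p -> odd p ->
  exists z : 'F_p, legendre_Fp z = -1.
Proof.
move=> p_pr op; have [z pz] := Fp_prim_root _ p_pr; exists z.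
have p_gt2 : (2 < p)%N by rewrite odd_prime_gt2.
have z0 : z != 0.
  apply/eqP => z0; move: (prim_expr_order pz); rewrite z0 expr0n.
  by rewrite (_ : p.-1 == 0%N = false) ?mulr0n => [/eqP|]; [rewrite eq_sym oner_eq0|lia].
case: (legendre_Fp_sign _ z) => [/eqP|[] // l1].
  by rewrite legendre_Fp_eq0 (negPf z0).
have : (p.-1 %| p./2)%N.
  by rewrite (prim_order_dvd pz) -euler_criterion // l1.
by have := odd_half _ op => hp /dvdn_leq; lia.
Qed.

(** * Gauss sums, quadratic reciprocity and the supplementary law for 2 *)

(** Such a root stands in for a primitive l-th root of unity: the vanishing sum yields both
    [zeta ^+ l = 1] and the orthogonality relation for the additive character. *)
Lemma cyclotomic_root (K : closedFieldType) (l : nat) : (1 < l)%N ->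
  exists zeta : K, \sum_(i < l) zeta ^+ i = 0.
Proof.
move=> l_gt1; have /closed_rootP[z rz] : size (\poly_(i < l) (1 : K)) != 1.
  by rewrite size_poly_eq ?oner_eq0 //; lia.
exists z; move: rz; rewrite /root horner_poly => /eqP rz; rewrite -[RHS]rz.
by apply: eq_bigr => i _; rewrite mul1r.
Qed.

Section GaussSum.

Variables (K : fieldType) (l : nat) (zeta : K).
Hypotheses (l_pr : prime l) (l_odd : odd l) (two_neq0 : 2%:R != 0 :> K).
Hypothesis zeta_sum : \sum_(i < l) zeta ^+ i = 0.

Let e (a : 'F_l) : K := zeta ^+ a.
Let eta (a : 'F_l) : K := (legendre_Fp a)%:~R.
Definition gauss_sum : K := \sum_a eta a * e a.

Let zetaX : zeta ^+ l = 1.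
Proof. by apply/eqP; rewrite -subr_eq0 subrX1 zeta_sum mulr0. Qed.

Let e_nat n : e n%:R = zeta ^+ n.
Proof. by rewrite /e val_Fp_nat // expr_mod. Qed.

Let eD a b : e (a + b) = e a * e b.
Proof. by rewrite -(natr_Zp a) -(natr_Zp b) -natrD !e_nat exprD. Qed.

Let etaM a b : eta (a * b) = eta a * eta b.
Proof. by rewrite /eta legendre_FpM // rmorphM. Qed.

Let e_sum : \sum_a e a = 0.
Proof.
transitivity (\sum_(i < (Zp_trunc (pdiv l)).+2) zeta ^+ i) => //.
by rewrite (Fp_cast l_pr).
Qed.

Let eta_sum : \sum_a eta a = 0.
Proof.
have [z lz] := nonresidue_exists _ l_pr l_odd.
have z0 : z != 0 by rewrite -legendre_Fp_eq0 lz.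
have : \sum_a eta a = - \sum_a eta a.
  rewrite {1}(reindex_inj (mulfI z0)) -sumrN; apply: eq_bigr => a _.
  by rewrite etaM {1}/eta lz mulN1r.
move/eqP; rewrite -subr_eq0 opprK -mulr2n -mulr_natl mulf_eq0 (negPf two_neq0).
by move/eqP.
Qed.

(** In the double sum, writing the second index as a c leaves eta c times the sum of e (a (1 + c))
    over nonzero a. This inner sum is l - 1 for c = -1 and -1 otherwise; as the values of [eta] sum
    to 0, only l at c = -1 survives. *)
Lemma gauss_sum_sqr :
  gauss_sum ^+ 2 = l%:R * (legendre_Fp (-1 : 'F_l))%:~R.
Proof.
have eta0 : eta 0 = 0 by rewrite /eta /legendre_Fp eqxx.
have e0 : e 0 = 1 by rewrite (e_nat 0).
have esum_mul c : \sum_(a | a != 0) e (a * c) = (if c == 0 then l%:R else 0) - 1.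
  case: eqVneq => [->|c0].
    rewrite (eq_bigr (fun=> 1)) => [|a _]; last by rewrite mulr0.
    by rewrite sumr_const cardC1 card_Fp // -subn1 natrB ?prime_gt0.
  have := e_sum; rewrite (reindex_inj (mulIf c0)) (bigD1 (0 : 'F_l)) //=.
  by rewrite mul0r e0 => /eqP; rewrite addrC addr_eq0 sub0r => /eqP.
rewrite expr2 /gauss_sum mulr_suml.
transitivity (\sum_(a | a != 0) \sum_c eta c * e (a * (1 + c))).
  rewrite (bigD1 (0 : 'F_l)) //= eta0 !mul0r add0r; apply: eq_bigr => a a0.
  rewrite mulr_sumr (reindex_inj (mulfI a0)); apply: eq_bigr => c _ /=.
  have eta2 : eta a * eta a = 1 by rewrite -rmorphM -expr2 legendre_Fp_sqr.
  by rewrite mulrDr mulr1 eD etaM -[in RHS](mul1r (eta c)) -eta2; ring.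
rewrite exchange_big /=.
under eq_bigr => c _ do rewrite -mulr_sumr esum_mul mulrBr mulr1.
rewrite sumrB eta_sum subr0 (bigD1 (-1)) //= subrr eqxx big1 ?addr0 1?mulrC //.
by move=> c cN1; rewrite addrC addr_eq0 (negPf cN1) mulr0.
Qed.

(** In characteristic p the p-th power is additive, fixes the values of [eta] because p is odd, and
    sends e a to e (p a). Reindexing by multiplication by p costs the factor eta p. *)
Lemma gauss_sum_Frobenius (p : nat) : p \in [pchar K] -> odd p -> p != l ->
  gauss_sum ^+ p = (legendre_Fp (p%:R : 'F_l))%:~R * gauss_sum.
Proof.
move=> pK op pl; have p_pr : prime p by case/andP: pK.
have p0 : (p%:R : 'F_l) != 0.
  by rewrite -(dvdn_pcharf (pchar_Fp l_pr)) dvdn_prime2 // eq_sym.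
have etaX (a : 'F_l) : eta a ^+ p = eta a.
  rewrite /eta; case: (legendre_Fp_sign _ a) => [|[]] ->.
  - by rewrite expr0n; case: p p_pr {pK op pl p0}.
  - by rewrite expr1n.
  - by rewrite mulrN1z -signr_odd op.
have eta2 : eta p%:R * eta p%:R = 1 by rewrite -rmorphM -expr2 legendre_Fp_sqr.
rewrite -(pFrobenius_autE pK) rmorph_sum /= /gauss_sum.
rewrite [in RHS](reindex_inj (mulfI p0)) mulr_sumr; apply: eq_bigr => a _ /=.
rewrite pFrobenius_autE exprMn etaX etaM mulrA -/(eta _) mulrA eta2 mul1r.
by congr (_ * _); rewrite -[in RHS](natr_Zp a) -natrM e_nat mulnC exprM.
Qed.

End GaussSum.

Lemma pchar_closed_field (p : nat) : prime p ->
  exists K : closedFieldType, p \in [pchar K].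
Proof.
move=> p_pr; have [K [iota _]] := countable_algebraic_closure 'F_p.
by exists K; rewrite (fmorph_pchar iota) pchar_Fp.
Qed.

Lemma pchar_two_neq0 (R : nzRingType) (p : nat) :
  p \in [pchar R] -> odd p -> 2%:R != 0 :> R.
Proof.
move=> pR op; rewrite -(dvdn_pcharf pR); have p_pr : prime p by case/andP: pR.
by rewrite dvdn_prime2 //; apply: contraTneq op => ->.
Qed.

(** Divisibility of integers by p is detected alike in ['F_p] and in any ring of characteristic p,
    so the criterion carries over to the field containing the roots of unity. *)
Lemma euler_criterion_pchar (R : nzRingType) (p : nat) (n : int) :
  p \in [pchar R] -> odd p ->
  (legendre_Fp (n%:~R : 'F_p))%:~R = n%:~R ^+ p./2 :> R.
Proof.
move=> pR op; have p_pr : prime p by case/andP: pR.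
have := euler_criterion _ (n%:~R : 'F_p) p_pr op.
move/eqP; rewrite -rmorphXn -subr_eq0 -rmorphB /= -(dvdz_pcharf (pchar_Fp p_pr)).
by rewrite (dvdz_pcharf pR) rmorphB subr_eq0 rmorphXn => /eqP.
Qed.

(** The Gauss sum g for l in characteristic p satisfies g^p = (p/l) g by Frobenius, and g^p = g (l
    s)^((p-1)/2) with s = (-1/l) from its square. Cancelling g and applying Euler's criterion gives
    the law; keeping a power of s shows that the sign depends on p only modulo 4. *)
Lemma quadratic_reciprocity (p l : nat) :
    prime p -> odd p -> prime l -> odd l -> p != l ->
  legendre_Fp (l%:Z%:~R : 'F_p) =
  legendre_Fp (p%:R : 'F_l) * legendre_Fp (-1 : 'F_l) ^+ p./2.
Proof.
move=> p_pr op l_pr ol pl; have [K pK] := pchar_closed_field _ p_pr.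
have [zeta z_sum] := cyclotomic_root K _ (prime_gt1 l_pr).
have two0 := pchar_two_neq0 _ _ pK op.
set s := legendre_Fp (-1 : 'F_l).
have g2 := gauss_sum_sqr _ _ _ l_pr ol two0 z_sum; rewrite -/s in g2.
have gp := gauss_sum_Frobenius _ _ _ l_pr ol z_sum _ pK op pl.
set g := gauss_sum _ _ _ in g2 gp.
have s2 : s ^+ 2 = 1 by rewrite legendre_Fp_sqr // oppr_eq0 oner_eq0.
have sX n : s ^+ n = 1 \/ s ^+ n = -1.
  have /eqP := congr1 (fun x : int => x ^+ n) s2.
  by rewrite expr1n -exprM mulnC exprM sqrf_eq1 => /orP[] /eqP; [left|right].
have g0 : g != 0.
  have : g ^+ 2 != 0; last by rewrite expf_eq0.
  rewrite g2 mulf_eq0 negb_or -(dvdn_pcharf pK) dvdn_prime2 // pl.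
  by case: (sX 1%N); rewrite expr1 => ->; rewrite ?rmorphN1 ?oppr_eq0 oner_eq0.
apply: (sign_intr_inj _ _ _ _ pK) => //; first exact: legendre_Fp_sign.
  by case: (sX p./2) => ->; case: (legendre_Fp_sign _ (p%:R : 'F_l)) => [|[]] ->; lia.
rewrite euler_criterion_pchar // rmorphM /=.
have : (g ^+ 2) ^+ p./2 = (legendre_Fp (p%:R : 'F_l))%:~R.
  apply: (mulIf g0); rewrite -gp -exprM mulnC odd_half // -exprSr prednK //.
  exact: prime_gt0.
rewrite g2 exprMn => <-; rewrite -mulrA rmorphXn -exprMn -expr2.
rewrite -[s%:~R ^+ 2]rmorphXn /= s2.
by rewrite expr1n mulr1.
Qed.

(** With z^4 = -1, z is a primitive eighth root of unity and z + 1/z, written [g 1], is a square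
    root of 2. Frobenius sends it to [g p], which depends only on p mod 8. *)
Lemma legendre_Fp_two (p : nat) : prime p -> odd p ->
  legendre_Fp (2%:~R : 'F_p) = if (p %% 8 \in [:: 1; 7])%N then 1 else -1.
Proof.
move=> p_pr op; have [K pK] := pchar_closed_field _ p_pr.
have /closed_rootP[z] : size ('X^4 - (-1)%:P : {poly K}) != 1.
  by rewrite size_XnsubC.
rewrite /root !hornerE subr_eq0 => /eqP z4.
have z0 : z != 0.
  by apply: contra_eq_neq z4 => ->; rewrite expr0n /= eq_sym oppr_eq0 oner_eq0.
have z8 : z ^+ 8 = 1 by rewrite (exprM z 4 2) z4 sqrrN expr1n.
pose g n := z ^+ n + z ^+ (7 * n).
have g2 : g 1%N ^+ 2 = 2%:R.
  rewrite /g; transitivity ((z ^+ 4) ^+ 2 * 2%:R + z ^+ 2 * (1 + (z ^+ 4) ^+ 3)); first by ring.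
  by rewrite z4; ring.
have gp : g 1%N ^+ p = g p.
  by rewrite -(pFrobenius_autE pK) rmorphD /= !pFrobenius_autE -!exprM mul1n.
have g_mod n : g n = g (n %% 8)%N.
  by rewrite /g -(expr_mod n z8) -(expr_mod (7 * n) z8) -(expr_mod (7 * (n %% 8)) z8) modnMmr.
have g0 : g 1%N != 0.
  suff : g 1%N ^+ 2 != 0 by rewrite expf_eq0.
  by rewrite g2 (pchar_two_neq0 _ _ pK).
apply: (sign_intr_inj _ _ _ _ pK) => //; [exact: legendre_Fp_sign | by case: ifP; lia |].
rewrite euler_criterion_pchar // -[2%:~R]/(2%:R) -g2; apply: (mulIf g0).
rewrite -exprM mulnC odd_half // -exprSr prednK ?prime_gt0 // gp g_mod.
have z5 : z ^+ 5 = - z by rewrite exprS z4 mulrN1.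
have z7 : z ^+ 7 = - z ^+ 3 by rewrite (exprD z 3 4) z4 mulrN1.
have : (p %% 8 \in [:: 1; 3; 5; 7])%N by rewrite !inE; lia.
rewrite !inE => /or4P[] /eqP -> /=; rewrite /g ?mulN1r ?mul1r.
- by [].
- by rewrite -[z ^+ (7 * 3)](expr_mod _ z8) z5 z7; ring.
- by rewrite -[z ^+ (7 * 5)](expr_mod _ z8) z5 z7; ring.
- by rewrite -[z ^+ (7 * 7)](expr_mod _ z8) addrC.
Qed.

(** * Periodic, completely multiplicative functions extending the symbol (A/p) *)

(** Modelled on the Kronecker symbol, with individual values prescribed only at odd primes not
    dividing [A]; it is compared with Legendre symbols only there. *)
Definition quadratic_character (A : int) (M : nat) (chi : nat -> int) :=
  [/\ (0 < M)%N, {morph chi : m n / (m * n)%N >-> m * n},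
      forall m n, m = n %[mod M] -> chi m = chi n
    & forall p, prime p -> odd p -> ~~ (p %| `|A|)%N ->
        chi p = legendre_Fp (A%:~R : 'F_p)].

Lemma quadratic_characterM A M chi A' M' chi' :
    quadratic_character A M chi -> quadratic_character A' M' chi' ->
  quadratic_character (A * A') (M * M') (fun n => chi n * chi' n).
Proof.
move=> [M0 chiM per_chi chiP] [M'0 chi'M per_chi' chi'P]; split.
- by rewrite muln_gt0 M0.
- by move=> m n; rewrite chiM chi'M; ring.
- move=> m n mn; rewrite (per_chi m n) 1?(per_chi' m n) //.
    by rewrite -(modn_dvdm m (dvdn_mull M (dvdnn M'))) mn modn_dvdm // dvdn_mull.
  by rewrite -(modn_dvdm m (dvdn_mulr M' (dvdnn M))) mn modn_dvdm // dvdn_mulr.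
- move=> p p_pr op; rewrite abszM Euclid_dvdM // negb_or => /andP[pA pA'].
  by rewrite chiP // chi'P // rmorphM legendre_FpM.
Qed.

(** For s = -1 this is the nontrivial Dirichlet character mod 4, for s = 1 the indicator of the odd
    numbers. With s = (-1/l) it carries the sign of the reciprocity law. *)
Definition sign_char (s : int) (n : nat) : int := if odd n then s ^+ n./2 else 0.

Lemma sign_char_prop (s : int) : s ^+ 2 = 1 ->
  {morph sign_char s : m n / (m * n)%N >-> m * n}
  /\ forall m n, m = n %[mod 4] -> sign_char s m = sign_char s n.
Proof.
move=> s2; have sE n : s ^+ n = s ^+ (odd n).
  by rewrite -[in LHS](odd_double_half n) exprD -mul2n exprM s2 expr1n mulr1.
rewrite /sign_char; split=> [m n|m n mn].
  rewrite oddM; case: (boolP (odd m)) => om; case: (boolP (odd n)) => on //=;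
    rewrite ?mul0r ?mulr0 // -exprD sE [RHS]sE; congr (s ^+ nat_of_bool _).
  have := odd_double_half m; have := odd_double_half n; rewrite om on.
  move: m./2 n./2 => i j <- <-.
  have -> : ((true + i.*2) * (true + j.*2) = true + (2 * (i * j) + i + j).*2)%N by nia.
  by rewrite half_bit_double; lia.
have -> : odd m = odd n by lia.
by case: ifP => // on; rewrite sE [RHS]sE; congr (s ^+ nat_of_bool _); lia.
Qed.

Lemma quadratic_character_N1 : quadratic_character (-1) 4 (sign_char (-1)).
Proof.
have [sM s_per] := sign_char_prop (-1) erefl; split=> // p p_pr op _.
apply: (sign_intr_inj _ _ _ _ (pchar_Fp p_pr)) => //; last 1 first.
- by rewrite euler_criterion // /sign_char op rmorphXn.
- by rewrite /sign_char op -signr_odd; case: (odd _); [right; right|right; left].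
- exact: legendre_Fp_sign.
Qed.

Lemma quadratic_character_2 : quadratic_character 2 8
  (fun n => if odd n then if (n %% 8 \in [:: 1; 7])%N then 1 else -1 else 0).
Proof.
split=> // [m n|m n mn|p p_pr op _]; last by rewrite legendre_Fp_two // op.
  rewrite oddM; case: (boolP (odd m)) => om; case: (boolP (odd n)) => on //=;
    rewrite ?mul0r ?mulr0 //.
  have : (m %% 8 \in [:: 1; 3; 5; 7])%N by rewrite !inE; lia.
  have : (n %% 8 \in [:: 1; 3; 5; 7])%N by rewrite !inE; lia.
  rewrite -modnMm !inE.
  by move=> /or4P[] /eqP -> /or4P[] /eqP ->.
by rewrite mn; have -> : odd m = odd n by lia.
Qed.

Lemma quadratic_character_odd_prime (l : nat) : prime l -> odd l ->
  exists chi, quadratic_character l (l * 4) chi.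
Proof.
move=> l_pr ol; set s := legendre_Fp (-1 : 'F_l).
have s2 : s ^+ 2 = 1 by rewrite legendre_Fp_sqr // oppr_eq0 oner_eq0.
have [sM s_per] := sign_char_prop _ s2.
exists (fun n => legendre_Fp (n%:R : 'F_l) * sign_char s n); split.
- by rewrite muln_gt0 prime_gt0.
- by move=> m n; rewrite sM natrM legendre_FpM //; ring.
- move=> m n mn; rewrite (s_per m n).
    suff -> : (m%:R : 'F_l) = n%:R by [].
    apply/val_inj; rewrite /= !val_Fp_nat //.
    by rewrite -(modn_dvdm m (dvdn_mulr 4 (dvdnn l))) mn modn_dvdm // dvdn_mulr.
  by rewrite -(modn_dvdm m (dvdn_mull l (dvdnn 4))) mn modn_dvdm // dvdn_mull.
- move=> p p_pr op; rewrite dvdn_prime2 // => pl.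
  by rewrite quadratic_reciprocity // /sign_char op.
Qed.

(** The symbol is multiplicative in [A], so products of the functions for -1, 2 and odd primes
    suffice; the induction splits off the least prime factor. *)
Lemma quadratic_character_exists (A : int) : A != 0 ->
  exists M chi, quadratic_character A M chi.
Proof.
have pos n : (0 < n)%N -> exists M chi, quadratic_character n M chi.
  elim/ltn_ind: n => n IHn n0; case: (ltnP 1 n) => [n1|n1]; last first.
    have -> : n = 1%N by lia.
    by exists 1%N, (fun=> 1); split=> // p p_pr op _; rewrite legendre_Fp1.
  have p_pr := pdiv_prime n1; set p := pdiv n in p_pr.
  have [M [chi chiP]] : exists M chi, quadratic_character p M chi.
    case: (even_prime p_pr) => [->|op]; first by eexists _, _; exact: quadratic_character_2.
    by have [chi chiP] := quadratic_character_odd_prime _ p_pr op; exists (p * 4)%N, chi.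
  have np : (n %/ p < n)%N by rewrite ltn_Pdiv // prime_gt1.
  have [|M' [chi' chi'P]] := IHn _ np.
    by rewrite divn_gt0 ?prime_gt0 // dvdn_leq // pdiv_dvd.
  exists (M * M')%N, (fun n => chi n * chi' n).
  have := quadratic_characterM _ _ _ _ _ _ chiP chi'P.
  by rewrite -PoszM mulnC divnK // pdiv_dvd.
case: A => n A0; first by apply: pos; lia.
have [//|M [chi chiP]] := pos n.+1.
exists (4 * M)%N, (fun n => sign_char (-1) n * chi n).
have := quadratic_characterM _ _ _ _ _ _ quadratic_character_N1 chiP.
by rewrite mulN1r -NegzE.
Qed.

(** * Character values as parities of valuations, and congruences between powers *)

(** Counted with multiplicity, each prime factor other than q contributes 1 and each factor q
    contributes -1. *)
Lemma multiplicative_val (chi : nat -> int) (q D : nat) :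
    {morph chi : m n / (m * n)%N >-> m * n} -> prime q -> chi q = -1 ->
    (0 < D)%N -> (forall p, prime p -> (p %| D)%N -> p != q -> chi p = 1) ->
  chi D = (-1) ^+ logn q D.
Proof.
move=> chiM q_pr chiq; have chi1 : chi 1%N = 1.
  by have := chiM 1%N q; rewrite mul1n chiq; lia.
elim/ltn_ind: D => D IHD D0 HD; case: (ltnP 1 D) => [D1|D1]; last first.
  by rewrite (_ : D = 1%N) ?chi1 ?logn1 //; lia.
have p_pr := pdiv_prime D1; have pD := pdiv_dvd D; set p := pdiv D in p_pr pD.
have Dp0 : (0 < D %/ p)%N by rewrite divn_gt0 ?prime_gt0 // dvdn_leq.
have -> : logn q D = (logn q (D %/ p) + logn q p)%N.
  by rewrite -(lognM q Dp0 (prime_gt0 p_pr)) divnK.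
rewrite -{1}(divnK pD) chiM exprD; congr (_ * _).
  apply: IHD => // [|r r_pr rD]; first by rewrite ltn_Pdiv // prime_gt1.
  by apply: HD => //; apply: dvdn_trans rD (dvdn_div pD).
case: (eqVneq p q) => [->|pq]; first by rewrite logn_prime // eqxx.
by rewrite HD // logn_prime // eq_sym (negPf pq).
Qed.

(* The primes of [W] being at most [B], each [p.-1] divides [B`!]. *)
Lemma expn_period (x W B n t : nat) : (0 < x)%N -> (0 < W)%N ->
    (forall p, prime p -> (p %| W)%N -> (p <= B)%N) -> (W * B`! %| t)%N ->
    (forall p, prime p -> (p %| x)%N -> (logn p W <= n)%N) ->
  x ^ (n + t) = x ^ n %[mod W].
Proof.
move=> x0 W0 WB Wt Wn; apply/eqP; rewrite eqn_mod_dvd ?leq_pexp2l ?leq_addr //.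
apply/dvdn_partP => // p; rewrite mem_primes => /and3P[p_pr _ pW].
rewrite expnD -{2}[(x ^ n)%N]muln1 -mulnBr p_part.
(* If p divides x, the p-part of W already divides x^n; otherwise Euler's theorem applies modulo
   that p-part. *)
case: (boolP (p %| x)%N) => px.
  by apply: dvdn_mulr; apply: dvdn_trans (dvdn_exp2r _ px); rewrite dvdn_exp2l // Wn.
apply: dvdn_mull; rewrite -eqn_mod_dvd ?expn_gt0 ?x0 //.
have k0 : (0 < logn p W)%N by rewrite logn_gt0 mem_primes p_pr W0.
have cop : coprime x (p ^ logn p W) by rewrite coprimeXr // coprime_sym prime_coprime.
have : (totient (p ^ logn p W) %| t)%N.
  apply: dvdn_trans Wt; rewrite totient_pfactor // mulnC; apply: dvdn_mul.
    by apply: dvdn_trans (pfactor_dvdnn p W); rewrite dvdn_exp2l // leq_pred.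
  have := WB _ p_pr pW; have := prime_gt1 p_pr => p1 pB.
  by rewrite dvdn_fact // -subn1 subn_gt0 p1 /=; lia.
by move=> /dvdnP[j ->]; rewrite mulnC expnM -modnXm Euler_exp_totient // modnXm exp1n.
Qed.

Lemma logn_eq_mod (p W a b : nat) : prime p -> (0 < a)%N -> (0 < b)%N ->
  a = b %[mod W] -> (p ^ (logn p a).+1 %| W)%N -> logn p b = logn p a.
Proof.
move=> p_pr a0 b0 ab pW; have pW' : (p ^ logn p a %| W)%N.
  by apply: dvdn_trans pW; rewrite dvdn_exp2l.
have dvd_ab d : (d %| W)%N -> (d %| a)%N = (d %| b)%N.
  by move=> dW; rewrite /dvdn -(modn_dvdm a dW) ab modn_dvdm.
apply/eqP; rewrite eqn_leq -ltnS -[(_ <= logn p b)%N]pfactor_dvdn // -dvd_ab // pfactor_dvdnn andbT.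
by rewrite ltnNge -pfactor_dvdn // -dvd_ab // pfactor_dvdn // ltnn.
Qed.

(** * Lifting the exponent at q *)

(** The expansion of X^(u+2) around Y. The quadratic term keeps its binomial coefficient because
    divisibility of that coefficient by q is needed when u + 2 = q. *)
Lemma subrXX2 (R : comNzRingType) (X Y : R) (u : nat) : exists z,
  X ^+ u.+2 - Y ^+ u.+2 = (X - Y) * (u.+2%:R * Y ^+ u.+1
    + (X - Y) * ('C(u.+2, 2)%:R * Y ^+ u + (X - Y) * z)).
Proof.
elim: u => [|u [z IH]].
  by exists 0; rewrite (_ : 'C(2, 2) = 1%N) //; ring.
exists ('C(u.+2, 2)%:R * Y ^+ u + X * z).
rewrite [X in X%:R * Y ^+ u.+1]binS bin1 natrD.
transitivity (X * (X ^+ u.+2 - Y ^+ u.+2) + Y ^+ u.+2 * (X - Y)); first by rewrite !exprS; ring.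
by rewrite IH !exprS; ring.
Qed.

Lemma subrXX1 (R : comNzRingType) (X Y : R) (u : nat) : exists z,
  X ^+ u.+1 - Y ^+ u.+1 = (X - Y) * (u.+1%:R * Y ^+ u + (X - Y) * z).
Proof.
case: u => [|u]; first by exists 0; ring.
by have [z ->] := subrXX2 _ X Y u; eexists.
Qed.

(** For prime [q] this forces z to be nonzero, whereas [logn] sends 0 to 0; the explicit cofactor
    suits ring computations. *)
Definition val_eq (q e : nat) (z : int) :=
  exists2 w : int, z = (q%:Z) ^+ e * w & ~~ (q%:Z %| w)%Z.

Lemma val_eq_logn (q e : nat) (z : int) : prime q ->
  val_eq q e z -> logn q `|z| = e.
Proof.
move=> q_pr [w -> qw]; have w0 : (0 < `|w|)%N.
  by rewrite absz_gt0; apply: contraNneq qw => ->; rewrite dvdz0.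
rewrite abszM abszX /= lognM ?expn_gt0 ?(prime_gt0 q_pr) // pfactorK // logn_coprime ?addn0 //.
by rewrite prime_coprime.
Qed.

Lemma logn_val_eq (q : nat) (z : int) : prime q -> z != 0 ->
  val_eq q (logn q `|z|) z.
Proof.
move=> q_pr z0; have dvdE k : (q%:Z ^+ k %| z)%Z = (k <= logn q `|z|)%N.
  by rewrite dvdzE abszX pfactor_dvdn ?absz_gt0.
have := dvdE (logn q `|z|); rewrite leqnn => /dvdzP[w zw].
exists w; first by rewrite mulrC.
apply/negP => /dvdzP[v wv]; have := dvdE (logn q `|z|).+1.
by rewrite ltnn {1}zw wv exprS -mulrA dvdz_mull.
Qed.

Lemma primez_dvdM (q : nat) (a b : int) : prime q ->
  (q%:Z %| a * b)%Z = (q%:Z %| a)%Z || (q%:Z %| b)%Z.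
Proof. by move=> q_pr; rewrite !dvdzE abszM Euclid_dvdM. Qed.

Lemma primez_dvdX (q : nat) (a : int) n : prime q ->
  (q%:Z %| a ^+ n)%Z = (q%:Z %| a)%Z && (0 < n)%N.
Proof. by move=> q_pr; rewrite !dvdzE abszX Euclid_dvdX. Qed.

(** The cofactor of X - Y is q Y^(q-1) plus terms divisible by q^2: the quadratic one because q
    divides X - Y and, q being odd, also the binomial coefficient; the rest because it contains (X -
    Y)^2. *)
Lemma val_eq_subX_prime (q e : nat) (X Y : int) :
    prime q -> odd q -> (0 < e)%N -> ~~ (q%:Z %| Y)%Z ->
  val_eq q e (X - Y) -> val_eq q e.+1 (X ^+ q - Y ^+ q).
Proof.
move=> q_pr oq; case: e => // e _ qY [w XY qw].
have q_gt2 : (2 < q)%N by rewrite odd_prime_gt2.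
have [k qk] : exists k, 'C(q, 2) = (k * q)%N.
  by apply/dvdnP; apply: prime_dvd_bin.
have [z] := subrXX2 _ X Y q.-2; rewrite (_ : q.-2.+2 = q); last by lia.
rewrite XY qk => ->.
exists (w * (Y ^+ q.-2.+1 + q%:Z * (q%:Z ^+ e * w * (k%:Z * Y ^+ q.-2 + q%:Z ^+ e * w * z)))).
  by rewrite natrM !natz !exprS; ring.
rewrite primez_dvdM // negb_or qw /= rpredDr ?dvdz_mulr //.
by rewrite primez_dvdX // (negPf qY).
Qed.

(** The cofactor of X - Y is T Y^(T-1) modulo q, hence prime to q. *)
Lemma val_eq_subX_coprime (q e T : nat) (X Y : int) :
    prime q -> (0 < e)%N -> ~~ (q%:Z %| Y)%Z -> ~~ (q %| T)%N ->
  val_eq q e (X - Y) -> val_eq q e (X ^+ T - Y ^+ T).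
Proof.
move=> q_pr e0 qY qT [w XY qw].
case: T qT => [|T qT]; first by rewrite dvdn0.
have [z ->] := subrXX1 _ X Y T.
exists (w * (T.+1%:R * Y ^+ T + (X - Y) * z)); first by rewrite XY; ring.
rewrite primez_dvdM // negb_or qw rpredDr.
  by rewrite natz primez_dvdM // primez_dvdX // (negPf qY) orbF dvdzE.
by rewrite XY -mulrA dvdz_mulr // dvdz_exp // dvdzz.
Qed.

Lemma val_eq_subX (q m j T : nat) (X Y : int) :
    prime q -> odd q -> (0 < m)%N -> ~~ (q%:Z %| Y)%Z -> ~~ (q %| T)%N ->
  val_eq q m (X - Y) ->
  val_eq q (m + j) (X ^+ (q ^ j * T) - Y ^+ (q ^ j * T)).
Proof.
move=> q_pr oq m0 qY qT XY; rewrite !exprM; apply: val_eq_subX_coprime => //.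
- by lia.
- by rewrite primez_dvdX // (negPf qY).
elim: j => [|j IHj]; first by rewrite addn0.
rewrite addnS expnSr !exprM; apply: val_eq_subX_prime => //; first by lia.
by rewrite primez_dvdX // (negPf qY).
Qed.

(** * The sequence N modulo powers of q *)

(** The sequence N of the overview, with x and y in place of a^2 and b^2. Exchanging x and y
    corresponds to negative exponents. *)
Definition exp_diff (c d x y : int) (n : nat) : int := d * x ^+ n - c * y ^+ n.

Lemma exp_diffD c d x y n t : exp_diff c d x y (n + t) =
  d * x ^+ n * (x ^+ t - y ^+ t) + y ^+ t * exp_diff c d x y n.
Proof. by rewrite /exp_diff !exprD; ring. Qed.

Section PrimePower.

Variables (q : nat) (c d x y : int).
Hypotheses (q_pr : prime q) (q_odd : odd q).
Hypotheses (qx : ~~ (q%:Z %| x)%Z) (qy : ~~ (q%:Z %| y)%Z) (qd : ~~ (q%:Z %| d)%Z).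

Let N := exp_diff c d x y.

(** In [exp_diffD] the first summand has valuation exactly e, as q divides neither d nor x, and the
    second has a larger one. *)
Lemma val_eq_exp_diff e n t :
  val_eq q e (x ^+ t - y ^+ t) -> (q%:Z ^+ e.+1 %| N n)%Z -> val_eq q e (N (n + t)).
Proof.
move=> [w xyw qw] /dvdzP[v Nv]; rewrite /N exp_diffD -/N xyw Nv.
exists (d * x ^+ n * w + q%:Z * (y ^+ t * v)); first by rewrite exprS; ring.
rewrite rpredDr; last exact: dvdz_mulr.
rewrite !primez_dvdM // primez_dvdX //.
by rewrite (negPf qx) (negPf qd) (negPf qw).
Qed.

(** A Hensel-type step: with N n = q^e v and x^t - y^t = q^e w, the term at n + t u is, modulo
    q^(e+1), q^e times a unit times d x^n w u + y^t v. This is linear in u with invertible leading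
    coefficient modulo q. *)
Lemma exp_diff_lift e n t : (0 < e)%N ->
    val_eq q e (x ^+ t - y ^+ t) -> (q%:Z ^+ e %| N n)%Z ->
  exists u, (q%:Z ^+ e.+1 %| N (n + t * u))%Z.
Proof.
move=> e0 [w xyw qw] /dvdzP[v Nv].
have q_pchar := pchar_Fp q_pr.
pose dw : 'F_q := (d * x ^+ n * w)%:~R.
have dw0 : dw != 0.
  rewrite /dw -(dvdz_pcharf q_pchar) !primez_dvdM // primez_dvdX //.
  by rewrite (negPf qx) (negPf qd) (negPf qw).
pose s : 'F_q := - (y ^+ t * v)%:~R / dw.
(* Adding q to the representative of s keeps its residue and makes the multiplier a successor. *)
have [u u1] : exists u, u.+1%:R = s.
  exists (s + q.-1)%N; rewrite -addnS prednK ?prime_gt0 //.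
  by rewrite natrD natr_Zp (pcharf0 q_pchar) addr0.
exists u.+1; rewrite /N exp_diffD -/N Nv !exprM.
have [z ->] := subrXX1 _ (x ^+ t) (y ^+ t) u.
rewrite xyw.
have : (q%:Z %| d * x ^+ n * w * u.+1%:R + y ^+ t * v)%Z.
  rewrite (dvdz_pcharf q_pchar) rmorphD rmorphM /= -/dw rmorph_nat u1.
  by rewrite /s mulrCA mulfV // mulr1 addNr.
(* The error term of the expansion carries q^(2e), and 2e >= e + 1 since e is positive. *)
move=> /dvdzP[z' z'E]; case: e e0 {Nv xyw} => // e _.
apply/dvdzP; exists ((y ^+ t) ^+ u * z' + d * x ^+ n * w * (q%:Z ^+ e * w * z)).
transitivity (q%:Z ^+ e.+1 * ((y ^+ t) ^+ u * (d * x ^+ n * w * u.+1%:R + y ^+ t * v)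
   + d * x ^+ n * w * (q%:Z ^+ e.+1 * w * z))).
  by rewrite [_ ^+ u.+1]exprS; ring.
by rewrite z'E [q%:Z ^+ e.+2]exprS [q%:Z ^+ e.+1]exprS; ring.
Qed.

Variables (m r k : nat).
Hypotheses (m_gt0 : (0 < m)%N) (r_gt0 : (0 < r)%N).
Hypotheses (val_r : val_eq q m (x ^+ r - y ^+ r)) (dvd_k : (q%:Z ^+ m %| N k)%Z).

Lemma val_eq_exp_sub j T : ~~ (q %| T)%N ->
  val_eq q (m + j) (x ^+ (r * (q ^ j * T)) - y ^+ (r * (q ^ j * T))).
Proof.
by move=> qT; rewrite !(exprM _ r); apply: val_eq_subX => //; rewrite primez_dvdX // (negPf qy).
Qed.

(** Starting from [dvd_k], each lift gains one power of q. Adding multiples of some t with q^(m+j)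
    dividing x^t - y^t then makes n large without losing divisibility. *)
Lemma exp_diff_dvd (j n0 : nat) :
  exists2 n, (n0 <= n)%N & (q%:Z ^+ (m + j) %| N n)%Z.
Proof.
have q1 : ~~ (q %| 1)%N by rewrite dvdn1; case: eqP q_pr => // ->.
have [n Hn] : exists n, (q%:Z ^+ (m + j) %| N n)%Z.
  elim: j => [|j [n IHj]]; first by exists k; rewrite addn0.
  have mj0 : (0 < m + j)%N by rewrite addn_gt0 m_gt0.
  have [u Hu] := exp_diff_lift (m + j)%N n _ mj0 (val_eq_exp_sub j 1 q1) IHj.
  by exists (n + r * (q ^ j * 1) * u)%N; rewrite addnS.
have [w xyw _] := val_eq_exp_sub j 1 q1.
set t := (r * (q ^ j * 1))%N in xyw.
have t0 : (0 < t)%N by rewrite !muln_gt0 r_gt0 expn_gt0 prime_gt0.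
clearbody t; exists (n + t * n0)%N; first by apply: leq_trans (leq_pmull n0 t0) (leq_addl _ _).
rewrite /N exp_diffD -/N !exprM rpredD // ?dvdz_mull //.
by rewrite subrXX xyw -mulrA dvdz_mulr.
Qed.

End PrimePower.

(** * Eventual sign of N, and its valuations at primes dividing x *)

Lemma expn_dominates (c x y : nat) : (0 < y)%N -> (y < x)%N ->
  exists n0, forall n, (n0 <= n)%N -> (c * y ^ n < x ^ n)%N.
Proof.
move=> y0 yx; exists (c * y)%N => n cn.
(* Bernoulli's inequality for (1 + 1/y)^n with denominators cleared, using x >= y + 1. *)
have bern : (y ^ n * (y + n) <= y * x ^ n)%N.
  elim: n {cn} => [|n IHn]; first by rewrite !expn0; lia.
  rewrite !expnS; nia.
have yn : (0 < y ^ n)%N by rewrite expn_gt0 y0.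
rewrite -(ltn_pmul2l y0); apply: leq_trans bern.
rewrite mulnA [(_ * _ ^ n)%N]mulnC ltn_pmul2l //; lia.
Qed.

(** The larger of x and y eventually dominates. A constant sign lets congruences between terms of N
    pass to their absolute values, on which the character is evaluated. *)
Lemma exp_diff_sign (c d : int) (x y : nat) :
    c != 0 -> d != 0 -> (0 < x)%N -> (0 < y)%N -> x != y ->
  exists n0, (forall n, (n0 <= n)%N -> 0 < exp_diff c d x y n) \/
             (forall n, (n0 <= n)%N -> exp_diff c d x y n < 0).
Proof.
have main (c' d' : int) (x' y' : nat) : d' != 0 -> (0 < y')%N -> (y' < x')%N ->
    exists n0, forall n, (n0 <= n)%N -> 0 < sgz d' * exp_diff c' d' x' y' n.
  move=> d0 y0 yx; have [n0 H] := expn_dominates `|c'| _ _ y0 yx; exists n0 => n /H cd.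
  rewrite /exp_diff mulrBr !mulrA -abszEsg -!natz -!natrX !natz.
  have : (x' ^ n <= `|d'| * x' ^ n)%N by rewrite leq_pmull // absz_gt0.
  move: cd; move: (x' ^ n)%N (y' ^ n)%N => X Y.
  have : sgz d' * c' <= `|c'|%N by case: (sgzP d'); lia.
  nia.
move=> c0 d0 x0 y0 xy.
case: (ltngtP x y) xy => // xy _.
  have [n0 H] := main d c y x c0 x0 xy; exists n0.
  have opp n : exp_diff c d x y n = - exp_diff d c y x n by rewrite /exp_diff opprB.
  by case: (sgzP c) c0 H => // _ _ H; [right|left] => n /H; rewrite opp; lia.
have [n0 H] := main c d x y d0 y0 xy; exists n0.
by case: (sgzP d) d0 H => // _ _ H; [left|right] => n /H; lia.
Qed.

(** Once p^(v_p(c)+1) divides x^n, it cannot divide the difference without dividing c y^n, hence c.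
    The bound is independent of n, which controls the modulus at primes where x is not
    invertible. *)
Lemma logn_exp_diff (c d : int) (x y p n : nat) : prime p -> c != 0 ->
    (p %| x)%N -> ~~ (p %| y)%N -> (`|c| <= n)%N ->
    (0 < `|exp_diff c d x y n|)%N ->
  (logn p `|exp_diff c d x y n| <= logn p `|c|)%N.
Proof.
move=> p_pr c0 px py cn N0; rewrite leqNgt; apply/negP => lt_N.
have c_gt0 : (0 < `|c|)%N by rewrite absz_gt0.
have lt_c : (logn p `|c| < n)%N by apply: leq_trans (ltn_logl _ c_gt0) cn.
have : (p%:Z ^+ (logn p `|c|).+1 %| c * y%:Z ^+ n)%Z.
  rewrite -[c * _](subKr (d * x%:Z ^+ n)) rpredB //; last first.
    by rewrite dvdzE abszX pfactor_dvdn.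
  apply: dvdz_mull; rewrite dvdzE !abszX /=.
  by apply: dvdn_trans (dvdn_exp2r _ px); rewrite dvdn_exp2l.
rewrite dvdzE abszM !abszX /= Gauss_dvdl; last first.
  by rewrite coprimeXl // coprimeXr // prime_coprime.
by rewrite pfactor_dvdn // ltnn.
Qed.

Lemma dvdz_exp_diff (c d : int) (x y W n t : nat) :
  x ^ (n + t) = x ^ n %[mod W] -> y ^ (n + t) = y ^ n %[mod W] ->
  (W%:Z %| exp_diff c d x y (n + t) - exp_diff c d x y n)%Z.
Proof.
move=> hx hy.
have dvdW (z : nat) : z ^ (n + t) = z ^ n %[mod W] ->
    (W%:Z %| z%:Z ^+ (n + t) - z%:Z ^+ n)%Z.
  by move=> hz; rewrite -eqz_mod_dvd -![z%:Z]natz -!natrX !natz !modz_nat hz.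
rewrite /exp_diff (_ : _ - _ = d * (x%:Z ^+ (n + t) - x%:Z ^+ n) - c * (y%:Z ^+ (n + t) - y%:Z ^+ n)); last by ring.
by rewrite rpredB // dvdz_mull // dvdW.
Qed.

Lemma prime_dvd_fact (p n : nat) : prime p -> (p %| n`!)%N -> (p <= n)%N.
Proof.
move=> p_pr; elim: n => [|n IHn]; first by rewrite dvdn1; case: eqP p_pr => // ->.
by rewrite factS Euclid_dvdM // => /orP[/dvdn_leq->//|/IHn/leqW].
Qed.

Lemma leq_logn (p n : nat) : (logn p n <= n)%N.
Proof. by case: n => [|n]; rewrite ?logn0 // ltnW // ltn_logl. Qed.

Lemma logn_part0 (p : nat) (pi : nat_pred) (n : nat) :
  p \notin pi -> logn p (n`_pi)%N = 0%N.
Proof.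
move=> p_pi; rewrite lognE; case: and3P => // -[p_pr _ pn].
by have := pnatP _ (part_gt0 pi n) (part_pnat pi n) p p_pr pn; rewrite (negPf p_pi).
Qed.

(** * Two terms of N with incompatible character values *)

Lemma nonresidue_divisor_absurd (chi : nat -> int) (c d : int)
    (x y q m r k M B : nat) :
  prime q -> odd q -> coprime x y -> x != y -> (0 < x)%N -> (0 < y)%N ->
  c != 0 -> d != 0 -> ~~ (q%:Z %| x%:Z)%Z -> ~~ (q%:Z %| y%:Z)%Z -> ~~ (q%:Z %| d)%Z ->
  (0 < m)%N -> (0 < r)%N -> val_eq q m (x%:Z ^+ r - y%:Z ^+ r) ->
  (q%:Z ^+ m %| exp_diff c d x y k)%Z ->
  {morph chi : m n / (m * n)%N >-> m * n} ->
  (forall m n, m = n %[mod M] -> chi m = chi n) -> chi q = -1 ->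
  (0 < M <= B)%N ->
  (forall n p, prime p -> (B < p)%N -> (p%:Z %| exp_diff c d x y n)%Z -> chi p = 1) ->
  False.
Proof.
move=> q_pr oq cxy xy x0 y0 c0 d0 qx qy qd m0 r0 val_r dvd_k chiM chi_per chiq.
case/andP=> M0 MB good.
have [n1 sgnN] := exp_diff_sign _ _ _ _ c0 d0 x0 y0 xy.
(* This will be the q-adic valuation of W B!, so both q^j T and q^(j+1) T are multiples of W B!. *)
pose j := logn q (M * B`!).
(* The exponent m + j + 2 exceeds both target valuations m + j and m + j + 1. The lower bound on n
   secures the sign and exceeds the exponents in W at primes dividing x or y. *)
have [n n_ge Nn] := exp_diff_dvd _ _ _ _ _ q_pr oq qx qy qd _ _ _ m0 r0 val_r dvd_k
  j.+2 (n1 + (M + (`|c| + `|d|) + B`!)).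
have n1n : (n1 <= n)%N by apply: leq_trans n_ge; exact: leq_addr.
have sum_n : (M + (`|c| + `|d|) + B`! <= n)%N by apply: leq_trans n_ge; exact: leq_addl.
have cd_n : (`|c| + `|d| <= n)%N.
  by apply: leq_trans sum_n; rewrite -addnA addnCA leq_addr.
have c_n : (`|c| <= n)%N by apply: leq_trans cd_n; exact: leq_addr.
have d_n : (`|d| <= n)%N by apply: leq_trans cd_n; exact: leq_addl.
pose u i := `|exp_diff c d x y i|%N.
have u0 i : (n <= i)%N -> (0 < u i)%N.
  move=> ni; have ni' := leq_trans n1n ni.
  by rewrite absz_gt0; case: sgnN => /(_ i ni'); [exact: lt0r_neq0|exact: ltr0_neq0].
pose pi : nat_pred := [pred p | (p <= B)%N && (p != q)].
(* Since h M divides W, congruences mod W become congruences mod M after division by h. The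
   prime-to-q part of B! adds a further power of each prime in [pi], enough to detect exact
   valuations, and leaves the q-part of W equal to that of M. *)
pose h := ((u n)`_pi)%N; pose W := (M * h * (B`!)`_q^')%N; pose T := ((W * B`!)`_q^')%N.
have h0 : (0 < h)%N by rewrite part_gt0.
have W0 : (0 < W)%N by rewrite !muln_gt0 M0 h0 part_gt0.
have q'T : ~~ (q %| T)%N.
  by have := part_pnat q^' (W * B`!); rewrite p'natE.
have qh : logn q h = 0%N.
  by apply: logn_part0; rewrite inE /= eqxx andbF.
have WT : (W * B`! %| q ^ j * T)%N.
  have WB0 : (0 < W * B`!)%N by rewrite muln_gt0 W0 fact_gt0.
  rewrite -[X in (X %| _)%N](partnC q WB0); apply: dvdn_mul => //; rewrite p_part.
  rewrite dvdn_exp2l // /j !lognM ?muln_gt0 ?M0 ?h0 ?part_gt0 ?fact_gt0 // qh.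
  rewrite [logn q _`_q^'](_ : _ = 0%N); last first.
    by apply: logn_part0; rewrite !inE negbK.
  by rewrite !addn0.
have hMW : (h * M %| W)%N by rewrite mulnC dvdn_mulr.
have WB p : prime p -> (p %| W)%N -> (p <= B)%N.
  move=> p_pr; rewrite !Euclid_dvdM // -orbA => /or3P[/dvdn_leq pM|ph|pB].
  - by apply: leq_trans MB; apply: pM.
  - by have := pnatP _ h0 (part_pnat pi (u n)) p p_pr ph; rewrite inE => /andP[].
  - by apply: prime_dvd_fact => //; apply: dvdn_trans pB (dvdn_part _ _).
have Wlog p : (logn p h <= `|c| + `|d|)%N -> (logn p W <= n)%N.
  move=> ph; rewrite /W !lognM ?muln_gt0 ?M0 ?h0 ?part_gt0 //.
  apply: leq_trans sum_n; rewrite !leq_add ?leq_logn //.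
  by apply: leq_trans (leq_logn _ _) (dvdn_leq (fact_gt0 _) (dvdn_part _ _)).
have logh p : (logn p h <= logn p (u n))%N.
  by apply: dvdn_leq_log; [exact: u0 | exact: dvdn_part].
have Wx p : prime p -> (p %| x)%N -> (logn p W <= n)%N.
  move=> p_pr px; apply: Wlog; apply: leq_trans (logh p) _.
  apply: leq_trans (logn_exp_diff _ _ _ _ _ _ p_pr c0 px _ _ _) _ => //; last 1 first.
  - by apply: leq_trans (leq_logn _ _) (leq_addr _ _).
  - by rewrite -prime_coprime //; apply: coprime_dvdl px cxy.
  - exact: u0.
have Wy p : prime p -> (p %| y)%N -> (logn p W <= n)%N.
  move=> p_pr py; apply: Wlog; apply: leq_trans (logh p) _.
  have uE : u n = `|exp_diff d c y x n|%N.
    by rewrite /u -abszN /exp_diff opprB.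
  rewrite uE; apply: leq_trans (logn_exp_diff _ _ _ _ _ _ p_pr d0 py _ _ _) _ => //; last 1 first.
  - by apply: leq_trans (leq_logn _ _) (leq_addl _ _).
  - by rewrite -prime_coprime //; apply: coprime_dvdl py _; rewrite coprime_sym.
  - by rewrite -uE; exact: u0.
(* The left side does not involve i: the cofactor at n + t is congruent to the one at n modulo M,
   for both choices of i. *)
have key i : (j <= i <= j.+1)%N -> chi ((u n)`_pi^')%N = (-1) ^+ (m + i).
  move=> /andP[ji ij]; set t := (r * (q ^ i * T))%N.
  have Wt : (W * B`! %| t)%N.
    by apply: dvdn_mull; apply: dvdn_trans WT _; rewrite dvdn_mul // dvdn_exp2l.
  have val_t : logn q (u (n + t)) = (m + i)%N.
    apply: val_eq_logn => //; apply: val_eq_exp_diff => //.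
      exact: val_eq_exp_sub.
    apply: dvdz_trans Nn; apply: dvdz_exp2l.
    by rewrite -addnS leq_add2l ltnS.
  have ut : u n = u (n + t)%N %[mod W].
    have := dvdz_exp_diff c d _ _ _ _ _ (expn_period _ _ _ _ _ x0 W0 WB Wt Wx)
      (expn_period _ _ _ _ _ y0 W0 WB Wt Wy).
    have n1nt : (n1 <= n + t)%N by apply: leq_trans n1n (leq_addr _ _).
    have WN : (W%:Z %| exp_diff c d x y (n + t) - exp_diff c d x y n)%Z ->
        (W%:Z %| (u (n + t)%N)%:Z - (u n)%:Z)%Z.
      case: sgnN => sgnN; rewrite /u.
        by rewrite !gtz0_abs ?sgnN.
      by rewrite !ltz0_abs ?sgnN // -opprD rpredN.
    by move=> /WN; rewrite -eqz_mod_dvd !modz_nat => /eqP[].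
  have ut0 : (0 < u (n + t))%N by apply: u0; exact: leq_addr.
  have ht : ((u (n + t))`_pi)%N = h.
    apply: eq_partn_from_log => // [|p]; first exact: u0.
    rewrite inE /= => /andP[pB pq].
    case: (boolP (prime p)) => p_pr; last by rewrite [LHS]lognE [RHS]lognE (negPf p_pr).
    apply: (logn_eq_mod _ W) => //; first exact: u0.
    have hp : logn p h = logn p (u n).
      rewrite -[in RHS](partnC pi (u0 n (leqnn n))) lognM ?part_gt0 //.
      by rewrite [X in (_ + X)%N]logn_part0 ?addn0 // !inE pB pq.
    rewrite -hp expnSr /W dvdn_mul //; first by rewrite dvdn_mull ?pfactor_dvdnn.
    have pBf : (p %| B`!)%N by rewrite dvdn_fact // prime_gt0.
    move: pBf; rewrite -{1}(partnC q (fact_gt0 B)) Gauss_dvdr // p_part.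
    by rewrite coprimeXr // prime_coprime // dvdn_prime2.
  (* The two terms have the common factor h and agree modulo h M. *)
  have DM : ((u n)`_pi^' = (u (n + t))`_pi^' %[mod M])%N.
    apply/eqP; rewrite -(eqn_pmul2l h0) !muln_modr -[in X in _ == X]ht !partnC //.
      by rewrite ht -(modn_dvdm (u n) hMW) ut modn_dvdm.
    exact: u0.
  rewrite (chi_per _ _ DM) (multiplicative_val _ q) // ?part_gt0 //.
    by rewrite -val_t -[in RHS](partnC pi ut0) lognM ?part_gt0 // ht qh.
  (* A prime factor of the cofactor other than q lies outside [pi], hence exceeds B. *)
  move=> p p_pr pD pq; apply: (good (n + t)%N) => //.
    rewrite ltnNge; apply/negP => pB.
    have := pnatP _ (part_gt0 _ _) (part_pnat pi^' (u (n + t)%N)) p p_pr pD.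
    by rewrite !inE pB pq.
  by rewrite dvdzE; apply: dvdn_trans pD (dvdn_part _ _).
have := key j; have := key j.+1; rewrite !leqnn !leqnSn addnS exprS => -> // /(_ isT).
by rewrite mulN1r; case: (odd (m + j)) (signr_odd int (m + j)) => <-.
Qed.

(** * Valuations and Legendre symbols of rationals in terms of integers *)

Lemma padic_val_frac (p : nat) (z w : int) : prime p -> z != 0 -> w != 0 ->
  ~~ (p%:Z %| w)%Z -> padic_val p (z%:~R / w%:~R) = ((logn p `|z|)%:Z)%:E.
Proof.
move=> p_pr z0 w0 pw; rewrite /padic_val.
set x := (_ / _); have x0 : x != 0 by rewrite mulf_neq0 ?invr_eq0 ?intr_eq0.
rewrite (negPf x0); congr (_%:E).
have : (numq x * w)%:~R = (z * denq x)%:~R :> rat.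
  by rewrite !rmorphM /= numqE mulrAC; congr (_ * _); rewrite divfK ?intr_eq0.
move/intr_inj => /(congr1 (fun n : int => logn p `|n|)).
rewrite !abszM !lognM ?absz_gt0 ?numq_eq0 ?denq_neq0 // [logn p `|w|]logn_coprime.
  by rewrite addn0 => ->; rewrite PoszD addrK.
by rewrite prime_coprime.
Qed.

Lemma padic_val_ge (p e : nat) (z w : int) : prime p -> w != 0 ->
  ~~ (p%:Z %| w)%Z ->
  ((e%:Z)%:E <= padic_val p (z%:~R / w%:~R))%E = (p%:Z ^+ e %| z)%Z.
Proof.
move=> p_pr w0 pw; have [->|z0] := eqVneq z 0.
  by rewrite mul0r /padic_val eqxx leey dvdz0.
by rewrite padic_val_frac // lee_fin dvdzE abszX pfactor_dvdn ?absz_gt0.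
Qed.

(** Numerator and denominator are coprime, so equal valuations must both be 0. *)
Lemma padic_val_eq0 (p : nat) (x : rat) : prime p -> x != 0 ->
  padic_val p x = 0%:E <-> ~~ (p%:Z %| numq x)%Z /\ ~~ (p%:Z %| denq x)%Z.
Proof.
move=> p_pr x0; rewrite /padic_val (negPf x0) !dvdzE.
have nx : (0 < `|numq x|)%N by rewrite absz_gt0 numq_eq0.
have dx : (0 < `|denq x|)%N by rewrite absz_gt0 denq_neq0.
split=> [[]/eqP|[pn pd]]; last first.
  by rewrite !logn_coprime ?subrr // prime_coprime.
rewrite subr_eq0 => /eqP[] eq_log.
have := coprime_num_den x; have := logn_gt0 p `|numq x|; have := logn_gt0 p `|denq x|.
rewrite !mem_primes p_pr nx dx eq_log /= => -> pE cop; rewrite -pE.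
suff pd : ~~ (p %| `|denq x|)%N by [].
apply/negP => pd; have := pd; rewrite pE => pn.
by have := coprime_dvdl pn cop; rewrite prime_coprime // pd.
Qed.

(** The product of numerator and denominator is x times the square of the denominator. *)
Lemma legendre_numq_denq (p : nat) (x : rat) : prime p -> odd p ->
  ~~ (p%:Z %| denq x)%Z ->
  legendre p x = legendre_Fp ((numq x * denq x)%:~R : 'F_p).
Proof.
move=> p_pr op pd; have d0 : (denq x)%:~R != 0 :> 'F_p.
  by rewrite -(dvdz_pcharf (pchar_Fp p_pr)).
rewrite /legendre /ratr rmorphM /=; set a := _%:~R; set b := _%:~R in d0 *.
have -> : a * b = a / b * (b * b) by rewrite mulrA divfK.
rewrite [RHS]legendre_FpM // [legendre_Fp (b * b)]legendre_FpM // -expr2.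
by rewrite legendre_Fp_sqr // mulr1.
Qed.

(** As x^r and y^r agree modulo q^m, exponents may be shifted by multiples of r, so -n can be
    replaced by -n + 2 r n = (2 r - 1) n. *)
Lemma neg_exponent_dvd (q m r n : nat) (c d x y : int) : prime q ->
    ~~ (q%:Z %| x)%Z -> ~~ (q%:Z %| y)%Z -> (0 < r)%N ->
    (q%:Z ^+ m %| x ^+ r - y ^+ r)%Z -> (q%:Z ^+ m %| exp_diff c d y x n)%Z ->
  exists k, (q%:Z ^+ m %| exp_diff c d x y k)%Z.
Proof.
move=> q_pr qx qy r0 xyr qN; exists (r * n + (r.-1 * n))%N.
have E : (r * n + r.-1 * n + n = r * (2 * n))%N.
  by case: r r0 {xyr} => // r _ /=; lia.
have cop : coprimez (q%:Z ^+ m) (x ^+ n * y ^+ n).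
  rewrite coprimezE abszX abszM !abszX coprimeXl // coprimeMr !coprimeXr //;
    by rewrite prime_coprime.
rewrite -(Gauss_dvdzl _ cop); set k := (r * n + r.-1 * n)%N in E *.
have -> : exp_diff c d x y k * (x ^+ n * y ^+ n) =
   d * y ^+ n * (x ^+ (r * (2 * n)) - y ^+ (r * (2 * n)))
   + y ^+ (r * (2 * n)) * exp_diff c d y x n.
  by rewrite -E /exp_diff ![_ ^+ (k + n)]exprD; ring.
apply: rpredD; last exact: dvdz_mull.
by apply: dvdz_mull; rewrite !(exprM _ r) subrXX; exact: dvdz_mulr.
Qed.

(** * Passage from the rationals to the integer sequence *)

Theorem theorem1p1 (alpha beta : rat)
  (alpha_neq0 : alpha != 0) (alpha_neq1 : alpha != 1) (alpha_neqN1 : alpha != -1)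
  (beta_neq0 : beta != 0) (beta_neq1 : beta != 1) (beta_neqN1 : beta != -1)
  (Hq : exists q : nat, [/\ prime q /\ odd q,
    padic_val q alpha = 0%:E /\ padic_val q beta = 0%:E,
    legendre q alpha = -1
    & exists k : int, (padic_val q (alpha ^+ q.-1 - 1)%R
                       <= padic_val q (alpha ^ (2 * k) - beta)%R)%E]) :
  special_pair alpha beta.
Proof.
case: Hq => q [[q_pr oq] [va vb] leg_q [k Hk]].
have [qa qb] := (padic_val_eq0 _ _ q_pr alpha_neq0).1 va.
have [qc qd] := (padic_val_eq0 _ _ q_pr beta_neq0).1 vb.
set a := numq alpha in qa; set b := denq alpha in qb.
set c := numq beta in qc; set d := denq beta in qd.
have a0 : a != 0 by rewrite numq_eq0.
have b0 : b != 0 by exact: denq_neq0.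
have c0 : c != 0 by rewrite numq_eq0.
have d0 : d != 0 by exact: denq_neq0.
have alphaE : alpha = a%:~R / b%:~R by rewrite divq_num_den.
have betaE : beta = c%:~R / d%:~R by rewrite divq_num_den.
have cop_ab : coprime `|a| `|b| by exact: coprime_num_den.
have leg_alpha p : prime p -> odd p -> ~~ (p%:Z %| b)%Z ->
    legendre p alpha = legendre_Fp ((a * b)%:~R : 'F_p).
  exact: legendre_numq_denq.
have val_alpha p : prime p -> ~~ (p%:Z %| a)%Z -> ~~ (p%:Z %| b)%Z ->
    padic_val p alpha = 0%:E.
  by move=> p_pr pa pb; apply/padic_val_eq0.
have val_beta p : prime p -> ~~ (p%:Z %| c)%Z -> ~~ (p%:Z %| d)%Z ->
    padic_val p beta = 0%:E.
  by move=> p_pr pc pd; apply/padic_val_eq0.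
clearbody a b c d.
(* Only even exponents occur, and squares are natural numbers whatever the sign of alpha. *)
pose x := (`|a| ^ 2)%N; pose y := (`|b| ^ 2)%N.
have sqrE (z : int) : (`|z| ^ 2)%N%:Z = z ^+ 2.
  by rewrite -natz natrX natz abszE real_normK ?num_real.
have xE : x%:Z = a ^+ 2 by exact: sqrE.
have yE : y%:Z = b ^+ 2 by exact: sqrE.
have x0 : (0 < x)%N by rewrite expn_gt0 absz_gt0 a0.
have y0 : (0 < y)%N by rewrite expn_gt0 absz_gt0 b0.
have cxy : coprime x y by rewrite coprimeXl // coprimeXr.
have xy : x != y.
  rewrite eqn_exp2r //; apply/eqP => ab.
  have : alpha ^+ 2 == 1.
    have ab2 : a ^+ 2 = b ^+ 2 by rewrite -xE -yE /x ab.
    rewrite alphaE expr_div_n -[a%:~R ^+ 2]rmorphXn -[b%:~R ^+ 2]rmorphXn /= ab2.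
    by rewrite divff // intr_eq0 expf_neq0.
  by rewrite sqrf_eq1 (negPf alpha_neq1) (negPf alpha_neqN1).
have qx : ~~ (q%:Z %| x%:Z)%Z by rewrite xE primez_dvdX // (negPf qa).
have qy : ~~ (q%:Z %| y%:Z)%Z by rewrite yE primez_dvdX // (negPf qb).
(* With this r, x^r - y^r = a^(q-1) - b^(q-1), whose q-adic valuation is that of alpha^(q-1) - 1 in
   hypothesis (iii). *)
pose r := q./2; have rq : (2 * r = q.-1)%N by rewrite mulnC odd_half.
have q_gt2 : (2 < q)%N by rewrite odd_prime_gt2.
have r0 : (0 < r)%N by rewrite half_gt0 ltnW.
have fracE n : alpha ^+ (2 * n) - beta =
    (exp_diff c d x y n)%:~R / (b ^+ (2 * n) * d)%:~R.
  rewrite alphaE betaE /exp_diff xE yE -!exprM expr_div_n !(rmorphB, rmorphM, rmorphXn) /=.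
  by field; rewrite intr_eq0 d0 expf_neq0 ?intr_eq0.
have fracVE n : alpha ^- (2 * n) - beta =
    (exp_diff c d y x n)%:~R / (a ^+ (2 * n) * d)%:~R.
  rewrite alphaE betaE /exp_diff xE yE -!exprM expr_div_n invf_div !(rmorphB, rmorphM, rmorphXn) /=.
  by field; rewrite intr_eq0 d0 expf_neq0 ?intr_eq0.
have den0 p n (e : int) : prime p -> ~~ (p%:Z %| e)%Z -> ~~ (p%:Z %| d)%Z ->
  ~~ (p%:Z %| e ^+ n * d)%Z.
  by move=> p_pr pe pd; rewrite primez_dvdM // negb_or primez_dvdX // (negPf pe).
have xyr0 : x%:Z ^+ r - y%:Z ^+ r != 0.
  by rewrite subr_eq0 -!natz -!natrX !natz; rewrite eqz_nat eqn_exp2r.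
have xyrE : x%:Z ^+ r - y%:Z ^+ r = a ^+ q.-1 - b ^+ q.-1.
  by rewrite xE yE -!exprM rq.
pose m := logn q `|x%:Z ^+ r - y%:Z ^+ r|.
have val_r := logn_val_eq _ _ q_pr xyr0; rewrite -/m in val_r.
have q_xyr : (q%:Z %| x%:Z ^+ r - y%:Z ^+ r)%Z.
  have qF := pchar_Fp q_pr.
  rewrite xyrE (dvdz_pcharf qF) rmorphB !rmorphXn /=.
  by rewrite !Fp_unitX ?subrr // -(dvdz_pcharf qF).
have m0 : (0 < m)%N.
  by rewrite logn_gt0 mem_primes q_pr absz_gt0 xyr0; move: q_xyr; rewrite dvdzE.
have val_m : padic_val q (alpha ^+ q.-1 - 1) = (m%:Z)%:E.
  rewrite -(padic_val_frac _ _ (b ^+ q.-1) q_pr xyr0) ?expf_neq0 //; last first.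
    by rewrite primez_dvdX // (negPf qb).
  congr padic_val; rewrite xyrE alphaE expr_div_n rmorphB !rmorphXn /=.
  by field; rewrite expf_neq0 ?intr_eq0.
rewrite val_m in Hk.
have [k' dvd_k] : exists k', (q%:Z ^+ m %| exp_diff c d x y k')%Z.
  case: k Hk => n Hk.
    exists n; rewrite -(padic_val_ge _ _ _ (b ^+ (2 * n) * d)) //.
    - by rewrite -fracE.
    - by rewrite mulf_neq0 ?expf_neq0.
    - exact: den0.
  (* Here k = -(n + 1), and alpha^(2k) - beta has numerator [exp_diff c d y x n.+1] over a
     denominator prime to q. *)
  apply: (neg_exponent_dvd q m r n.+1) => //.
    by have [w ->] := val_r; rewrite dvdz_mulr.
  rewrite -(padic_val_ge _ _ _ (a ^+ (2 * n.+1) * d)) //.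
  - by rewrite -fracVE.
  - by rewrite mulf_neq0 ?expf_neq0.
  - exact: den0.
have [M [chi [M0 chiM chi_per chiP]]] := quadratic_character_exists (a * b) (mulf_neq0 a0 b0).
have chi_legendre p : prime p -> odd p -> ~~ (p%:Z %| a)%Z -> ~~ (p%:Z %| b)%Z ->
    chi p = legendre p alpha.
  move=> p_pr op pa pb; rewrite chiP ?leg_alpha //.
  by rewrite abszM Euclid_dvdM // negb_or; apply/andP.
move=> /finite_seqP[s sE].
(* The list [s] holds the supposedly finitely many primes of the definition. A prime above B is odd,
   divides none of a, b, c, d, and is not in [s]. *)
pose small := [:: q; M; `|a|%N; `|b|%N; `|c|%N; `|d|%N] ++ s.
pose B := \max_(i <- small) i.
have leB i : i \in small -> (i <= B)%N by move=> si; apply: leq_bigmax_seq si isT.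
apply: (nonresidue_divisor_absurd chi c d x y q m r k' M B) => //.
- by rewrite chi_legendre.
- by rewrite M0 leB // !inE eqxx ?orbT.
move=> n p p_pr Bp pN.
have ndvd (z : int) : z != 0 -> `|z|%N \in small -> ~~ (p%:Z %| z)%Z.
  move=> z0 zs; rewrite dvdzE gtnNdvd // ?absz_gt0 //.
  exact: leq_ltn_trans (leB _ zs) Bp.
have pa : ~~ (p%:Z %| a)%Z by apply: ndvd; rewrite // !inE eqxx ?orbT.
have pb : ~~ (p%:Z %| b)%Z by apply: ndvd; rewrite // !inE eqxx ?orbT.
have pc : ~~ (p%:Z %| c)%Z by apply: ndvd; rewrite // !inE eqxx ?orbT.
have pd : ~~ (p%:Z %| d)%Z by apply: ndvd; rewrite // !inE eqxx ?orbT.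
have qp : (q < p)%N by apply: leq_ltn_trans Bp; rewrite leB // inE eqxx.
have op : odd p.
  by case: (even_prime p_pr) => // p2; move: qp; rewrite p2 ltnNge ltnW.
rewrite chi_legendre //; rewrite leg_alpha //.
(* The symbol is nonzero, and the value -1 would put p in [s], contradicting p > B. *)
case: (legendre_Fp_sign _ ((a * b)%:~R : 'F_p)) => [/eqP|[]//].
  rewrite legendre_Fp_eq0 rmorphM mulf_eq0.
  by rewrite -!(dvdz_pcharf (pchar_Fp p_pr)) (negPf pa) (negPf pb).
rewrite -leg_alpha // => leg_p; have ps : [set` s]%classic p.
  rewrite -sE; split=> //.
  - by rewrite val_alpha ?val_beta.
  - exists n%:Z; rewrite -[1%:E]/((1%N%:Z)%:E) (_ : alpha ^ (2 * n%:Z) = alpha ^+ (2 * n)) //.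
    rewrite fracE padic_val_ge //; last exact: den0.
    by rewrite mulf_neq0 ?expf_neq0.
by have := leB p; rewrite mem_cat ps orbT leqNgt Bp => /(_ isT).
Qed.
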